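(* Let $(n_k)_{k\ge1}$ be a sequence of positive integers such that $n_k$ divides $n_{k+1}$ for all $k$ and $\lim_{k\to\infty}n_k=\infty$, and let $\mathrm{UHF}(\vec n)$ be the associated uniformly hyperfinite algebra. For $1\le p\le\infty$ and an arbitrary function $w:\mathbb{N}_0\to(0,\infty)$, the generalized approximation space $\tilde E^p_w$ is a dense $*$-subalgebra of $\mathrm{UHF}(\vec n)$, and $\tilde E^p_w$ is inverse-closed in $\mathrm{UHF}(\vec n)$.
   Context: Let $M_n$ be the algebra of complex $n\times n$ matrices. Let $\phi_{k,\infty}:M_{n_k}\to\mathcal{B}(\ell^2(\mathbb{N}))$ map $A$ to the block diagonal operator $\operatorname{diag}(A,A,A,\dots)$. Since $n_k\mid n_{k+1}$, the images $\phi_{k,\infty}(M_{n_k})$ form an increasing sequence of $*$-subalgebras, and $\mathrm{UHF}(\vec n)=\overline{\bigcup_k\phi_{k,\infty}(M_{n_k})}$, closure in the operator norm; it is a unital $C^*$-algebra. Set $X_0=\{0\}$, $X_k=\phi_{k,\infty}(M_{n_k})$ for $k\ge1$, and $E_n(a)=\inf_{x\in X_n}\|a-x\|$ for $a\in\mathrm{UHF}(\vec n)$, $n\in\mathbb{N}_0$. The space $\tilde E^p_w$ consists of all $a\in\mathrm{UHF}(\vec n)$ for which $\|a\|_{\tilde E^p_w}=\left(\sum_{n\ge0}E_n(a)^pw(n)^p\right)^{1/p}$ is finite (for $p=\infty$: $\sup_{n\ge0}E_n(a)w(n)<\infty$). A subalgebra $\mathcal{A}\subseteq\mathcal{B}$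 with common unit is inverse-closed in $\mathcal{B}$ if $a\in\mathcal{A}$, $a^{-1}\in\mathcal{B}$ imply $a^{-1}\in\mathcal{A}$. *)

(* Defs.v *)
From HB Require Import structures.
From mathcomp Require Import all_boot all_order all_algebra.
From mathcomp Require Import complex.
From mathcomp Require Import all_classical all_reals all_analysis.
From mathcomp Require Import ring lra.

Set Implicit Arguments.
Unset Strict Implicit.
Unset Printing Implicit Defensive.

Import Order.TTheory GRing.Theory Num.Theory.
Import numFieldNormedType.Exports.
Import Normc.

Local Open Scope classical_set_scope.
Local Open Scope ring_scope.
Local Open Scope complex_scope.

Section SquareSummable.
Context {R : realType}.
Implicit Types x y : nat -> R[i].

Definition sqsum x : \bar R := (\sum_(0 <= i <oo) (normc (x i) ^+ 2)%:E)%E.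

Definition square_summable : {pred nat -> R[i]} := fun x => (sqsum x < +oo)%E.

Lemma normc_ge0 (z : R[i]) : 0 <= normc z.
Proof. by case: z => a b /=; rewrite sqrtr_ge0. Qed.

Lemma ler_normcD (a b : R[i]) : normc (a + b) <= normc a + normc b.
Proof.
have := ler_normD a b.
by rewrite /Num.norm /= -rmorphD lecR.
Qed.

Lemma sqsum_ge0 x : (0 <= sqsum x)%E.
Proof. by apply: nneseries_ge0 => i _ _; rewrite lee_fin sqr_ge0. Qed.

Lemma sqsum0 : sqsum (0 : nat -> R[i]) = 0%E.
Proof.
apply: eseries0 => i _ _ /=.
by rewrite /GRing.zero /= expr0n /= addr0 sqrtr0 expr0n.
Qed.

Lemma sqsumZ (k : R[i]) x : sqsum (k *: x) = ((normc k ^+ 2)%:E * sqsum x)%E.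
Proof.
rewrite -nneseriesZl; last by move=> i _; rewrite lee_fin sqr_ge0.
by apply: eq_eseriesr => i _; rewrite [(k *: x) i]/(k * x i) normcM exprMn EFinM.
Qed.

(* Convexity of the square, from which both closure under sums and
   the Minkowski inequality follow. *)
Lemma le_sqsumD (s t : R) x y : 0 < s -> 0 < t ->
  (sqsum (x + y)%R <=
     ((s + t) / s)%:E * sqsum x + ((s + t) / t)%:E * sqsum y)%E.
Proof.
move=> s0 t0.
have st0 : 0 < s + t by rewrite addr_gt0.
have q0 (z : nat -> R[i]) (c : R) : 0 <= c -> forall i : nat, true -> (0 <= c%:E * (normc (z i) ^+ 2)%:E)%E.
  by move=> c0 i _; rewrite -EFinM lee_fin mulr_ge0 ?sqr_ge0.
have cs : 0 <= (s + t) / s by rewrite divr_ge0 ?ltW.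
have ct : 0 <= (s + t) / t by rewrite divr_ge0 ?ltW.
rewrite -!nneseriesZl; try by move=> i _; rewrite lee_fin sqr_ge0.
rewrite -nneseriesD; try by move=> i _; exact: q0.
apply: lee_nneseries => [i _ _|i _]; first by rewrite lee_fin sqr_ge0.
rewrite -!EFinM -EFinD lee_fin.
apply: (@le_trans _ _ ((normc (x i) + normc (y i)) ^+ 2)).
  by rewrite lerXn2r ?nnegrE ?normc_ge0 ?addr_ge0 ?normc_ge0 // ler_normcD.
move: (normc (x i)) (normc (y i)) => u v.
have -> : (s + t) / s * u ^+ 2 + (s + t) / t * v ^+ 2 =
   (u + v) ^+ 2 + (u * t - v * s) ^+ 2 / (s * t).
  by field; rewrite !gt_eqF.
by rewrite lerDl divr_ge0 ?sqr_ge0 // mulr_ge0 // ltW.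
Qed.

Lemma square_summable_subsemimod : GRing.subsemimod_closed square_summable.
Proof.
split; [split|]; rewrite ?unfold_in.
- by rewrite sqsum0 ltry.
- move=> x y; rewrite !unfold_in => hx hy.
  apply: (le_lt_trans (le_sqsumD x y ltr01 ltr01)).
  by rewrite lte_add_pinfty // lte_mul_pinfty // lee_fin divr1 addr_ge0.
- move=> k x; rewrite !unfold_in => hx.
  by rewrite sqsumZ lte_mul_pinfty // lee_fin sqr_ge0.
Qed.

End SquareSummable.

Record ell2 (R : realType) :=
  Ell2 { ell2_seq :> nat -> R[i]; _ : square_summable ell2_seq }.

HB.instance Definition _ (R : realType) := [isSub for @ell2_seq R].
HB.instance Definition _ (R : realType) := [Choice of ell2 R by <:].
HB.instance Definition _ (R : realType) :=
  GRing.SubChoice_isSubLmodule.Build R[i] (nat -> R[i]) _ (ell2 R)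
    square_summable_subsemimod.

Section Ell2Norm.
Context {R : realType}.
Implicit Types x y : ell2 R.

Definition ell2_norm x : R := Num.sqrt (fine (sqsum x)).

Lemma ell2_normE x : ((ell2_norm x ^+ 2)%:E = sqsum x)%E.
Proof.
case: x => x hx; rewrite /ell2_norm /= sqr_sqrtr ?fine_ge0 ?sqsum_ge0 //.
by rewrite fineK // ge0_fin_numE ?sqsum_ge0.
Qed.

Lemma ell2_norm_ge0 x : 0 <= ell2_norm x.
Proof. exact: sqrtr_ge0. Qed.

Lemma ell2_norm_le x (M : R) : 0 <= M ->
  (ell2_norm x <= M) = (sqsum x <= (M ^+ 2)%:E)%E.
Proof.
by move=> M0; rewrite -ell2_normE lee_fin ler_pXn2r ?nnegrE ?ell2_norm_ge0.
Qed.

Lemma ell2_norm_sum x N : \sum_(0 <= i < N) normc (x i) ^+ 2 <= ell2_norm x ^+ 2.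
Proof.
rewrite -lee_fin ell2_normE -sumEFin.
by apply: nneseries_lim_ge => i _ _; rewrite lee_fin sqr_ge0.
Qed.

Lemma normc_le_ell2_norm x i : normc (x i) <= ell2_norm x.
Proof.
rewrite -(@ler_pXn2r _ 2) ?nnegrE ?ell2_norm_ge0 ?normc_ge0 //.
apply: le_trans (ell2_norm_sum x i.+1).
by rewrite big_nat_recr //= lerDr sumr_ge0 // => k _; rewrite sqr_ge0.
Qed.

Lemma ell2_norm0_eq0 x : ell2_norm x = 0 -> x = 0.
Proof.
move=> x0; apply: val_inj; apply/funext => i /=; apply: eq0_normc.
by apply/eqP; rewrite eq_le normc_ge0 -x0 normc_le_ell2_norm.
Qed.

Lemma ell2_normZ (k : R[i]) x : ell2_norm (k *: x) = normc k * ell2_norm x.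
Proof.
rewrite /ell2_norm sqsumZ -ell2_normE -EFinM /= -exprMn sqrtr_sqr.
by rewrite ger0_norm ?mulr_ge0 ?normc_ge0 ?ell2_norm_ge0 //= sqrtr_sqr ger0_norm ?ell2_norm_ge0.
Qed.

Lemma ler_ell2_normD x y : ell2_norm (x + y) <= ell2_norm x + ell2_norm y.
Proof.
have [/eqP x0|x0] := boolP (ell2_norm x == 0).
  by rewrite (ell2_norm0_eq0 x0) add0r lerDr ell2_norm_ge0.
have [/eqP y0|y0] := boolP (ell2_norm y == 0).
  by rewrite (ell2_norm0_eq0 y0) addr0 lerDl ell2_norm_ge0.
have {}x0 : 0 < ell2_norm x by rewrite lt0r x0 ell2_norm_ge0.
have {}y0 : 0 < ell2_norm y by rewrite lt0r y0 ell2_norm_ge0.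
rewrite ell2_norm_le ?addr_ge0 ?ell2_norm_ge0 //.
apply: (le_trans (le_sqsumD _ _ x0 y0)).
rewrite -!ell2_normE -!EFinM -EFinD lee_fin le_eqVlt; apply/orP; left.
by apply/eqP; field; rewrite !gt_eqF.
Qed.

End Ell2Norm.

Section Ell2Normed.
Variable R : realType.

Let nrm (x : ell2 R) : R[i] := (ell2_norm x)%:C.

Let ler_nrmD x y : nrm (x + y) <= nrm x + nrm y.
Proof. by rewrite /nrm -rmorphD lecR ler_ell2_normD. Qed.

Let nrmZ (k : R[i]) x : nrm (k *: x) = `|k| * nrm x.
Proof. by rewrite /nrm ell2_normZ rmorphM. Qed.

Let nrm0_eq0 x : nrm x = 0 -> x = 0.
Proof. by move=> /complexI/ell2_norm0_eq0. Qed.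

HB.instance Definition _ :=
  @Lmodule_isNormed.Build R[i] (ell2 R) nrm ler_nrmD nrmZ nrm0_eq0.

End Ell2Normed.

Definition ell2_dot {R : realType} (x y : ell2 R) : R[i] :=
  limn (series (fun i => x i * (y i)^* : R[i]^o)).

Definition bounded_linear {R : realType} (T : ell2 R -> ell2 R) : Prop :=
  linear T /\ exists M : R, forall x, ell2_norm (T x) <= M * ell2_norm x.

Record bop (R : realType) :=
  Bop { bop_fun :> ell2 R -> ell2 R; _ : `[< bounded_linear bop_fun >] }.

HB.instance Definition _ (R : realType) := [isSub for @bop_fun R].
HB.instance Definition _ (R : realType) := [Choice of bop R by <:].

Section BoundedOperators.
Variable R : realType.
Implicit Types (S T : bop R) (x y : ell2 R).

Lemma bounded_linear_subsemimod : GRing.subsemimod_closed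
  ((fun f => `[< bounded_linear f >]) : {pred ell2 R -> ell2 R}).
Proof.
split; [split|]; rewrite ?unfold_in.
- apply/asboolP; split; first by move=> k x y; rewrite scaler0 addr0.
  exists 0 => x; rewrite mul0r.
  have -> : (0 : ell2 R -> ell2 R) x = (0 : R[i]) *: x by rewrite scale0r.
  by rewrite ell2_normZ /= expr0n /= addr0 sqrtr0 mul0r.
- move=> f g; rewrite !unfold_in => /asboolP[lS [M hS]] /asboolP[lT [N hT]].
  apply/asboolP; split.
    move=> k x y; rewrite [LHS]/(f _ + g _) lS lT.
    by rewrite [RHS]/(k *: (f x + g x) + (f y + g y)) scalerDr; exact: addrACA.
  exists (M + N) => x; apply: (le_trans (ler_ell2_normD _ _)).
  by rewrite mulrDl lerD.
- move=> c g; rewrite !unfold_in => /asboolP[lT [N hT]].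
  apply/asboolP; split.
    move=> k x y; transitivity (c *: (k *: g x + g y)); first by rewrite -lT.
    rewrite [RHS]/(k *: (c *: g x) + c *: g y).
    by rewrite scalerDr !scalerA mulrC.
  exists (normc c * N) => x; rewrite [X in ell2_norm X]/(c *: g x).
  by rewrite ell2_normZ -mulrA ler_wpM2l ?normc_ge0.
Qed.

HB.instance Definition _ :=
  GRing.SubChoice_isSubLmodule.Build R[i] (ell2 R -> ell2 R) _ (bop R)
    bounded_linear_subsemimod.

Lemma bopP T : bounded_linear T.
Proof. by case: T => f /= /[dup] /asboolP. Qed.

HB.instance Definition _ T :=
  GRing.isLinear.Build R[i] (ell2 R) (ell2 R) *:%R T (bopP T).1.

Lemma bounded_linear_id : `[< bounded_linear (@idfun (ell2 R)) >].
Proof.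
apply/asboolP; split; first by move=> k x y.
by exists 1 => x; rewrite mul1r.
Qed.

Lemma bounded_linear_comp S T : `[< bounded_linear (S \o T) >].
Proof.
apply/asboolP; split; first by move=> k x y; rewrite /= !linearP.
have [_ [M hM]] := bopP S; have [_ [N hN]] := bopP T.
exists (`|M| * N) => x /=; apply: (le_trans (hM _)).
apply: (@le_trans _ _ (`|M| * ell2_norm (T x))).
  by rewrite ler_wpM2r ?ell2_norm_ge0 ?ler_norm.
by rewrite -mulrA ler_wpM2l.
Qed.

Definition bop_one : bop R := Bop bounded_linear_id.
Definition bop_comp S T : bop R := Bop (bounded_linear_comp S T).

Lemma bop_ext S T : (forall x, S x = T x) -> S = T.
Proof. by move=> h; apply: val_inj; apply/funext. Qed.

Lemma bop_addE S T x : (S + T) x = S x + T x.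
Proof. by []. Qed.

Lemma bop_scaleE (k : R[i]) T x : (k *: T) x = k *: T x.
Proof. by []. Qed.

Lemma bop_compA : associative bop_comp.
Proof. by move=> S T U; apply: bop_ext. Qed.

Lemma bop_comp1l : left_id bop_one bop_comp.
Proof. by move=> T; apply: bop_ext. Qed.

Lemma bop_comp1r : right_id bop_one bop_comp.
Proof. by move=> T; apply: bop_ext. Qed.

Lemma bop_compDl : left_distributive bop_comp +%R.
Proof. by move=> S T U; apply: bop_ext. Qed.

Lemma bop_compDr : right_distributive bop_comp +%R.
Proof. by move=> S T U; apply: bop_ext => x; rewrite /= raddfD. Qed.

Lemma square_summable_delta0 :
  square_summable (fun i : nat => (i == 0)%:R : R[i]).
Proof.
rewrite /square_summable /sqsum (@nneseriesD1 _ _ 0%N) //; last first.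
  by move=> k _; rewrite lee_fin sqr_ge0.
rewrite eseries0 ?adde0 ?ltry // => i _ /andP[_ /negbTE ->] /=.
by rewrite !expr0n /= addr0 sqrtr0 expr0n.
Qed.

Lemma bop_one_neq0 : bop_one != 0.
Proof.
apply/eqP => /(congr1 (fun T : bop R => T (Ell2 square_summable_delta0) 0%N)).
by move=> /eqP; rewrite [X in X == _]/= oner_eq0.
Qed.

HB.instance Definition _ := GRing.Zmodule_isNzRing.Build (bop R)
  bop_compA bop_comp1l bop_comp1r bop_compDl bop_compDr bop_one_neq0.

Lemma bop_scaleAl (k : R[i]) S T : k *: (S * T) = (k *: S) * T.
Proof. exact: bop_ext. Qed.

HB.instance Definition _ :=
  GRing.Lmodule_isLalgebra.Build R[i] (bop R) bop_scaleAl.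

Lemma bop_scaleAr (k : R[i]) S T : k *: (S * T) = S * (k *: T).
Proof. by apply: bop_ext => x; symmetry; exact: (linearZ_LR (S : {linear _ -> _})). Qed.

HB.instance Definition _ :=
  GRing.Lalgebra_isAlgebra.Build R[i] (bop R) bop_scaleAr.

(* The norm of a normedModType over R[i] has values in R[i]; opnorm is the
   real number with `|T| = (opnorm T)%:C. *)
Definition opnorm T : R :=
  sup [set ell2_norm (T x) | x in [set x | ell2_norm x <= 1]].

Lemma ell2_norm0 : ell2_norm (0 : ell2 R) = 0.
Proof. by rewrite /ell2_norm sqsum0 sqrtr0. Qed.

Lemma opnorm_has_sup T :
  has_sup [set ell2_norm (T x) | x in [set x | ell2_norm x <= 1]].
Proof.
split; first by exists (ell2_norm (T 0)), 0 => //=; rewrite ell2_norm0.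
have [_ [M hM]] := bopP T; exists `|M| => _ [x /= x1 <-].
apply: (le_trans (hM x)); apply: (@le_trans _ _ (`|M| * ell2_norm x)).
  by rewrite ler_wpM2r ?ell2_norm_ge0 ?ler_norm.
by rewrite ler_piMr.
Qed.

Lemma opnorm_ub T x : ell2_norm x <= 1 -> ell2_norm (T x) <= opnorm T.
Proof. by move=> x1; apply: (ub_le_sup (opnorm_has_sup T).2); exists x. Qed.

Lemma opnorm_ge0 T : 0 <= opnorm T.
Proof.
apply: (le_trans (ell2_norm_ge0 (T 0))).
by apply: opnorm_ub; rewrite ell2_norm0.
Qed.

Lemma ell2_norm_bop T x : ell2_norm (T x) <= opnorm T * ell2_norm x.
Proof.
have [/eqP /ell2_norm0_eq0 ->|x0] := boolP (ell2_norm x == 0).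
  by rewrite linear0 ell2_norm0 mulr0.
have {}x0 : 0 < ell2_norm x by rewrite lt0r x0 ell2_norm_ge0.
have ni : normc (ell2_norm x)^-1%:C = (ell2_norm x)^-1.
  by rewrite /= expr0n addr0 sqrtr_sqr ger0_norm // invr_ge0 ltW.
have := @opnorm_ub T ((ell2_norm x)^-1%:C *: x).
rewrite linearZ !ell2_normZ ni mulVf ?gt_eqF // => /(_ (lexx _)).
by rewrite mulrC ler_pdivrMr.
Qed.

Lemma opnorm_le T (M : R) : 0 <= M ->
  (forall x, ell2_norm (T x) <= M * ell2_norm x) -> opnorm T <= M.
Proof.
move=> M0 hM; apply: ge_sup; first exact: (opnorm_has_sup T).1.
by move=> _ [x /= x1 <-]; apply: (le_trans (hM x)); rewrite ler_piMr.
Qed.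

Lemma ler_opnormM S T : opnorm (S * T) <= opnorm S * opnorm T.
Proof.
apply: opnorm_le => [|x]; first by rewrite mulr_ge0 ?opnorm_ge0.
apply: (le_trans (ell2_norm_bop S (T x))).
by rewrite -mulrA ler_wpM2l ?opnorm_ge0 ?ell2_norm_bop.
Qed.

Lemma ler_opnormD S T : opnorm (S + T) <= opnorm S + opnorm T.
Proof.
apply: opnorm_le => [|x]; first by rewrite addr_ge0 ?opnorm_ge0.
apply: (le_trans (ler_ell2_normD (S x) (T x))).
by rewrite mulrDl lerD ?ell2_norm_bop.
Qed.

Lemma opnormZ (k : R[i]) T : opnorm (k *: T) = normc k * opnorm T.
Proof.
have leZ (c : R[i]) U : opnorm (c *: U) <= normc c * opnorm U.
  apply: opnorm_le => [|x]; first by rewrite mulr_ge0 ?normc_ge0 ?opnorm_ge0.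
  by rewrite bop_scaleE ell2_normZ -mulrA ler_wpM2l ?normc_ge0 ?ell2_norm_bop.
apply/eqP; rewrite eq_le leZ /=.
have [->|k0] := eqVneq k 0.
  by rewrite /= expr0n /= addr0 sqrtr0 mul0r opnorm_ge0.
have nk0 : 0 < normc k.
  rewrite lt0r normc_ge0 andbT; apply: contra k0 => /eqP/eq0_normc ->.
  by rewrite eqxx.
rewrite -ler_pdivlMl // -{1}(scale1r T) -(mulVf k0) -scalerA.
apply: (le_trans (leZ _ _)); rewrite ler_wpM2r ?opnorm_ge0 //.
rewrite -(@ler_pM2r _ (normc k)) // -normcM (mulVf k0).
rewrite (mulVf (lt0r_neq0 nk0)) /=.
by rewrite expr0n /= addr0 expr1n sqrtr1.
Qed.

Lemma opnorm0_eq0 T : opnorm T = 0 -> T = 0.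
Proof.
move=> T0; apply: bop_ext => x; apply: ell2_norm0_eq0.
apply/eqP; rewrite eq_le ell2_norm_ge0 andbT.
by have := ell2_norm_bop T x; rewrite T0 mul0r.
Qed.

Let nrm T : R[i] := (opnorm T)%:C.

Let ler_nrmD S T : nrm (S + T) <= nrm S + nrm T.
Proof. by rewrite /nrm -rmorphD lecR ler_opnormD. Qed.

Let nrmZ (k : R[i]) T : nrm (k *: T) = `|k| * nrm T.
Proof. by rewrite /nrm opnormZ rmorphM. Qed.

Let nrm0_eq0 T : nrm T = 0 -> T = 0.
Proof. by move=> /complexI/opnorm0_eq0. Qed.

HB.instance Definition _ :=
  @Lmodule_isNormed.Build R[i] (bop R) nrm ler_nrmD nrmZ nrm0_eq0.

Lemma bop_normE T : `|T| = (opnorm T)%:C.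
Proof. by []. Qed.

(* The adjoint as a relation; it determines T from S. *)
Definition is_adjoint S T : Prop :=
  forall x y, ell2_dot (S x) y = ell2_dot x (T y).

End BoundedOperators.

Section BlockDiagonal.
Context {R : realType}.

Definition ord_modn (m i : nat) (j : 'I_m) : 'I_m :=
  Ordinal (ltn_pmod i (leq_ltn_trans (leq0n j) (ltn_ord j))).

(* Row i of diag(A, A, A, ...) is row (i mod m) of A, placed in the columns
   of the block number (i / m). *)
Definition blockdiag (m : nat) (A : 'M[R[i]]_m) (x : nat -> R[i]) : nat -> R[i] :=
  fun i => \sum_(j < m) A (ord_modn i j) j * x (i %/ m * m + j)%N.

Lemma blockdiag_linear m (A : 'M[R[i]]_m) (k : R[i]) (x y : nat -> R[i]) i :
  blockdiag A (k *: x + y) i = k * blockdiag A x i + blockdiag A y i.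
Proof.
rewrite /blockdiag mulr_sumr -big_split /=; apply: eq_bigr => j _.
by rewrite [(k *: x + y) _]/(k * x _ + y _) mulrDr mulrCA.
Qed.

Lemma normc_sum (I : Type) (s : seq I) (F : I -> R[i]) :
  normc (\sum_(i <- s) F i) <= \sum_(i <- s) normc (F i).
Proof.
elim: s => [|a s IH]; first by rewrite !big_nil /= expr0n /= addr0 sqrtr0.
by rewrite !big_cons (le_trans (ler_normcD _ _)) // lerD2l.
Qed.

Lemma sum_block (F : nat -> R) (m N : nat) :
  \sum_(0 <= i < N * m) F i =
  \sum_(0 <= q < N) \sum_(j < m) F (q * m + j)%N.
Proof.
elim: N => [|N IH]; first by rewrite mul0n !big_nil.
rewrite big_nat_recr //= -IH mulSn addnC.
rewrite (@big_cat_nat _ _ _ (N * m)) ?leq_addr //=; congr (_ + _).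
rewrite -{1}[(N * m)%N]add0n big_addn addKn big_mkord.
by apply: eq_bigr => j _; rewrite addnC.
Qed.

Let mxsum (m : nat) (A : 'M[R[i]]_m) : R := \sum_r \sum_j normc (A r j).

Let mxsum_ge0 m (A : 'M[R[i]]_m) : 0 <= mxsum A.
Proof. by rewrite sumr_ge0 // => r _; rewrite sumr_ge0 // => j _; rewrite normc_ge0. Qed.

Lemma blockdiag_entry m (A : 'M[R[i]]_m) x (q : nat) (r : 'I_m) :
  normc (blockdiag A x (q * m + r)%N) ^+ 2 <=
    mxsum A ^+ 2 * \sum_(j < m) normc (x (q * m + j)%N) ^+ 2.
Proof.
have m0 : (0 < m)%N by exact: leq_ltn_trans (ltn_ord r).
set U := \sum_(j < m) _.
have U0 : 0 <= U by rewrite sumr_ge0 // => j _; rewrite sqr_ge0.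
rewrite -(sqr_sqrtr U0) -exprMn ler_pXn2r ?nnegrE ?normc_ge0 //; last first.
  by rewrite mulr_ge0 ?sqrtr_ge0.
rewrite /blockdiag divnMDl // divn_small ?ltn_ord // addn0.
apply: (le_trans (normc_sum _ _)).
have xU (j : 'I_m) : normc (x (q * m + j)%N) <= Num.sqrt U.
  rewrite -[leLHS]ger0_norm ?normc_ge0 // -sqrtr_sqr ler_sqrt //.
  rewrite /U (bigD1 j) //= lerDl sumr_ge0 // => i _; exact: sqr_ge0.
have rE (j : 'I_m) : ord_modn (q * m + r) j = r.
  by apply: val_inj; rewrite /= modnMDl modn_small.
apply: (@le_trans _ _ (\sum_(j < m) normc (A r j) * Num.sqrt U)).
  by apply: ler_sum => j _; rewrite rE normcM ler_wpM2l ?normc_ge0.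
rewrite -mulr_suml ler_wpM2r ?sqrtr_ge0 //.
rewrite /mxsum [leRHS](bigD1 r) //= lerDl sumr_ge0 // => i _.
by rewrite sumr_ge0 // => j _; rewrite normc_ge0.
Qed.

Lemma sqsum_blockdiag m (A : 'M[R[i]]_m) (x : ell2 R) :
  (sqsum (blockdiag A x) <= ((m%:R * mxsum A ^+ 2) * ell2_norm x ^+ 2)%:E)%E.
Proof.
apply: lime_le.
  by apply: is_cvg_nneseries => i _ _; rewrite lee_fin sqr_ge0.
apply: nearW => N; rewrite sumEFin lee_fin.
case: m A => [A|m A].
  rewrite !mul0r big1 // => i _; rewrite /blockdiag big_ord0.
  by rewrite /= !expr0n /= addr0 sqrtr0 expr0n.
apply: (@le_trans _ _ (\sum_(0 <= i < N * m.+1) normc (blockdiag A x i) ^+ 2)).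
  rewrite [leRHS](@big_cat_nat _ _ _ N) ?leq_pmulr //= lerDl.
  by rewrite sumr_ge0 // => i _; rewrite sqr_ge0.
rewrite sum_block.
apply: (@le_trans _ _ (\sum_(0 <= q < N) m.+1%:R * mxsum A ^+ 2 *
    \sum_(j < m.+1) normc (x (q * m.+1 + j)%N) ^+ 2)).
  apply: ler_sum => q _.
  apply: (le_trans (ler_sum _ (fun r _ => blockdiag_entry A x q r))).
  by rewrite sumr_const card_ord -mulrA [leRHS]mulr_natl.
rewrite -mulr_sumr -(sum_block (fun i => normc (x i) ^+ 2)) ler_wpM2l ?ell2_norm_sum //.
by rewrite mulr_ge0 ?sqr_ge0.
Qed.

Lemma square_summable_blockdiag m (A : 'M[R[i]]_m) (x : ell2 R) :
  square_summable (blockdiag A x).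
Proof. by apply: (le_lt_trans (sqsum_blockdiag A x)); rewrite ltry. Qed.

Lemma bounded_linear_blockdiag m (A : 'M[R[i]]_m) :
  `[< bounded_linear (fun x => Ell2 (square_summable_blockdiag A x)) >].
Proof.
apply/asboolP; split.
  move=> k x y; apply: val_inj; apply/funext => i.
  exact: blockdiag_linear.
exists (Num.sqrt (m%:R * mxsum A ^+ 2)) => x.
have h : 0 <= m%:R * mxsum A ^+ 2 by rewrite mulr_ge0 ?sqr_ge0.
rewrite ell2_norm_le ?mulr_ge0 ?sqrtr_ge0 ?ell2_norm_ge0 //.
by rewrite exprMn sqr_sqrtr // sqsum_blockdiag.
Qed.

Definition phi (m : nat) (A : 'M[R[i]]_m) : bop R :=
  Bop (bounded_linear_blockdiag A).

End BlockDiagonal.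

Section UHF.
Context {R : realType}.
Variable n : nat -> nat.

Definition UHF : set (bop R) :=
  closure (\bigcup_(k in [set k | (1 <= k)%N]) range (@phi R (n k))).

Definition uhf_level (k : nat) : set (bop R) :=
  if k is 0%N then [set 0] else range (@phi R (n k)).

Definition approx_err (k : nat) (a : bop R) : R :=
  inf [set opnorm (a - x) | x in uhf_level k].

(* The value at p = -oo is irrelevant: only 1 <= p is considered. *)
Definition approx_norm (p : \bar R) (w : nat -> R) (a : bop R) : \bar R :=
  match p with
  | r%:E => ((\sum_(0 <= k <oo) (approx_err k a `^ r * w k `^ r)%:E) `^ r^-1)%E
  | +oo%E => ereal_sup (range (fun k => (approx_err k a * w k)%:E))
  | -oo%E => 0%E
  end.

Definition approx_space (p : \bar R) (w : nat -> R) : set (bop R) :=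
  [set a | UHF a /\ (approx_norm p w a < +oo)%E].

End UHF.

Definition unital_star_subalgebra {R : realType} (A B : set (bop R)) : Prop :=
  [/\ A `<=` B, GRing.subalg_closed [in A] &
      forall S, A S -> exists2 T, A T & is_adjoint S T].

Definition dense_in {T : topologicalType} (A B : set T) : Prop :=
  A `<=` B /\ B `<=` closure A.

Definition inverse_closed {V : nzRingType} (A B : set V) : Prop :=
  forall a b, A a -> B b -> a * b = 1 -> b * a = 1 -> A b.

(* Main.v *)
Require Import Defs.
From mathcomp Require Import all_boot all_order all_algebra.
From mathcomp Require Import all_classical all_reals all_analysis.
From mathcomp Require Import complex.
From mathcomp Require Import ring lra.

(**
Write [E k a] for the distance from [a] to the [k]-th level.  An element [a] is
in UHF iff [E k a] tends to [0], because the levels increase.  Hence an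
inequality [E k c <= C * (E k a + E k b)] for all [k] carries membership in UHF
and finiteness of the weighted l^p norm from [a] and [b] to [c], whatever the
weight is.  Each level is a finite-dimensional *-algebra, which gives such
inequalities for linear combinations, products (replace an approximant [y] of
[b] with [opnorm y > 2 * opnorm b] by [0]) and adjoints.  For the inverse [b] of
[a], an approximant [x] of [a] with [2 * opnorm b * opnorm (a - x) < 1] is
bounded below, hence an invertible matrix whose inverse has norm at most
[2 * opnorm b]; so [E k b <= 2 * opnorm b ^+ 2 * E k a].  Density holds because
[E l x] vanishes for [l >= k] when [x] lies in the [k]-th level.
*)

Set Implicit Arguments.
Unset Strict Implicit.
Unset Printing Implicit Defensive.

Import Order.TTheory GRing.Theory Num.Theory.
Import numFieldNormedType.Exports Normc.

Local Open Scope classical_set_scope.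
Local Open Scope ring_scope.
Local Open Scope complex_scope.

(** * The inner product of ell2 *)

Section InnerProduct.
Context {R : realType}.
Implicit Types (x y : ell2 R) (z : R[i]).

Lemma normc_ge_ReIm z : `|complex.Re z| <= normc z /\ `|complex.Im z| <= normc z.
Proof.
case: z => a b /=; rewrite -!sqrtr_sqr !ler_sqrt ?addr_ge0 ?sqr_ge0 //.
by rewrite lerDl lerDr !sqr_ge0.
Qed.

Lemma normc_le_ReIm z : normc z <= `|complex.Re z| + `|complex.Im z|.
Proof.
case: z => a b /=; rewrite -(@ler_pXn2r _ 2) ?nnegrE ?sqrtr_ge0 ?addr_ge0 //.
rewrite sqr_sqrtr ?addr_ge0 ?sqr_ge0 // sqrrD !real_normK ?num_real //.
by rewrite -addrA lerD2l lerDr mulrn_wge0 // mulr_ge0.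
Qed.

Lemma normc_conjc z : normc (conjc z) = normc z.
Proof. by case: z => a b /=; rewrite sqrrN. Qed.

(** The norm of [R[i]] is itself complex-valued; this form lets later estimates work with a real
    [e]. *)
Lemma cvg_complexP (u : nat -> R[i]) z :
  (u @ \oo --> (z : R[i]^o)) <->
  forall e : R, 0 < e -> \forall n \near \oo, normc (z - u n) < e.
Proof.
rewrite (@cvgrPdist_lt _ R[i]^o); split=> [h e e0|h].
  have := h e%:C; rewrite ltcR => /(_ e0); apply: filterS => n.
  by rewrite ltcR.
(* Positivity in the order of [R[i]] forces a zero imaginary part, so the radius is real. *)
move=> [e b]; rewrite ltcE /= => /andP[/eqP -> e0].
by apply: filterS (h e e0) => n; rewrite -ltcR.
Qed.

Lemma cvg_complex (u : nat -> R[i]) (a b : R) :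
  (fun n => complex.Re (u n)) @ \oo --> a ->
  (fun n => complex.Im (u n)) @ \oo --> b -> u @ \oo --> (Complex a b : R[i]^o).
Proof.
move=> /cvgrPdist_lt ha /cvgrPdist_lt hb; apply/cvg_complexP => e e0.
have e20 : 0 < e / 2 by rewrite divr_gt0.
near=> n; apply: (le_lt_trans (normc_le_ReIm _)); rewrite (splitr e) ltrD //.
  have : `|a - complex.Re (u n)| < e / 2 by near: n; exact: ha.
  by case: (u n).
have : `|b - complex.Im (u n)| < e / 2 by near: n; exact: hb.
by case: (u n).
Unshelve. all: by end_near. Qed.

(** Cauchy-Schwarz for partial sums. The AM-GM weights are chosen so that the two resulting bounds
    add up to exactly [s * t]; they divide by the norms, so vanishing norms are treated first. *)
Lemma sum_normc_ell2 x y N :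
  \sum_(0 <= i < N) normc (x i) * normc (y i) <= ell2_norm x * ell2_norm y.
Proof.
have [/eqP/ell2_norm0_eq0 ->|x0] := boolP (ell2_norm x == 0).
  rewrite ell2_norm0 mul0r big1 // => i _.
  by rewrite [(0 : ell2 R) i]/(0 : R[i]) normc0 mul0r.
have [/eqP/ell2_norm0_eq0 ->|y0] := boolP (ell2_norm y == 0).
  rewrite ell2_norm0 mulr0 big1 // => i _.
  by rewrite [(0 : ell2 R) i]/(0 : R[i]) normc0 mulr0.
have := ell2_norm_sum x N; have := ell2_norm_sum y N.
have {}x0 : 0 < ell2_norm x by rewrite lt0r x0 ell2_norm_ge0.
have {}y0 : 0 < ell2_norm y by rewrite lt0r y0 ell2_norm_ge0.
move: (ell2_norm x) (ell2_norm y) x0 y0 => s t s0 t0 hy hx.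
(* AM-GM: [a b <= (t a^2 / s + s b^2 / t) / 2] *)
apply: (@le_trans _ _ (\sum_(0 <= i < N)
   (t / (2 * s) * normc (x i) ^+ 2 + s / (2 * t) * normc (y i) ^+ 2))).
  apply: ler_sum => i _; move: (normc (x i)) (normc (y i)) => a b.
  rewrite -subr_ge0.
  have -> : t / (2 * s) * a ^+ 2 + s / (2 * t) * b ^+ 2 - a * b =
     (t * a - s * b) ^+ 2 / (2 * s * t).
    by field; rewrite !gt_eqF.
  by rewrite divr_ge0 ?sqr_ge0 // !mulr_ge0 // ltW.
rewrite big_split /= -!mulr_sumr.
have -> : s * t = t / (2 * s) * s ^+ 2 + s / (2 * t) * t ^+ 2.
  by field; rewrite !gt_eqF.
by rewrite lerD // ler_wpM2l // divr_ge0 ?ltW // mulr_gt0.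
Qed.

Lemma real_series_cvg (u : nat -> R) (M : R) :
  (forall N, \sum_(0 <= i < N) `|u i| <= M) -> cvgn (series u).
Proof.
move=> hM; apply: normed_cvg; apply: nondecreasing_is_cvgn.
  apply/nondecreasing_seqP => N; rewrite /series /= [leRHS]big_nat_recr //=.
  by rewrite lerDl.
by exists M => _ [N _ <-]; exact: hM.
Qed.

(** [ell2_dot] is a [limn], hence meaningful only once convergence is known. By Cauchy-Schwarz the
    real and imaginary parts converge absolutely. *)
Lemma ell2_dot_cvg x y :
  series (fun i => x i * conjc (y i) : R[i]^o) @ \oo --> (ell2_dot x y : R[i]^o).
Proof.
suff [z hz] : exists z : R[i],
    series (fun i => x i * conjc (y i) : R[i]^o) @ \oo --> (z : R[i]^o).
  by rewrite /ell2_dot (cvg_lim (@norm_hausdorff _ _) hz).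
have hN i : normc (x i * conjc (y i)) = normc (x i) * normc (y i).
  by rewrite normcM normc_conjc.
have bnd (f : R[i] -> R) : (forall z, `|f z| <= normc z) ->
    cvgn (series (fun i => f (x i * conjc (y i)))).
  move=> hf; apply: (@real_series_cvg _ (ell2_norm x * ell2_norm y)) => N.
  apply: le_trans (sum_normc_ell2 x y N).
  by apply: ler_sum => i _; rewrite -hN.
have /cvg_ex[a ha] := bnd _ (fun z => (normc_ge_ReIm z).1).
have /cvg_ex[b hb] := bnd _ (fun z => (normc_ge_ReIm z).2).
exists (Complex a b); apply: cvg_complex.
  apply: cvg_trans ha; apply: near_eq_cvg; apply: nearW => n.
  rewrite !seriesEnat /=; elim: n => [|n IH]; first by rewrite !big_nil.
  rewrite !big_nat_recr //= IH.
  by case: (\sum_(0 <= i < n) _) (x n * _) => [? ?] [].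
apply: cvg_trans hb; apply: near_eq_cvg; apply: nearW => n.
rewrite !seriesEnat /=; elim: n => [|n IH]; first by rewrite !big_nil.
rewrite !big_nat_recr //= IH.
by case: (\sum_(0 <= i < n) _) (x n * _) => [? ?] [].
Qed.

Lemma ell2_dot_unique x y z :
  (series (fun i => x i * conjc (y i) : R[i]^o) @ \oo --> (z : R[i]^o)) ->
  ell2_dot x y = z.
Proof. by move=> hz; rewrite /ell2_dot (cvg_lim (@norm_hausdorff _ _) hz). Qed.

Lemma ell2_dot_linearl (k : R[i]) x x' y :
  ell2_dot (k *: x + x') y = k * ell2_dot x y + ell2_dot x' y.
Proof.
apply: ell2_dot_unique; pose u := fun i => x i * conjc (y i) : R[i]^o.
pose v := fun i => x' i * conjc (y i) : R[i]^o.
rewrite (_ : series _ = (k \*: series u) + series v).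
  by apply: cvgD; [apply: cvgZl_tmp|]; exact: ell2_dot_cvg.
apply/funext => N; transitivity (k * (\sum_(0 <= i < N) x i * conjc (y i) ) +
   \sum_(0 <= i < N) x' i * conjc (y i) ) => [|//].
rewrite /series /= mulr_sumr -big_split /=; apply: eq_bigr => i _.
by transitivity ((k * x i + x' i) * conjc (y i) ) => //; rewrite mulrDl -mulrA.
Qed.

Lemma ell2_dot_linearr (k : R[i]) x y y' :
  ell2_dot x (k *: y + y') = conjc k * ell2_dot x y + ell2_dot x y'.
Proof.
apply: ell2_dot_unique; pose u := fun i => x i * conjc (y i) : R[i]^o.
pose v := fun i => x i * conjc (y' i) : R[i]^o.
rewrite (_ : series _ = (conjc k \*: series u) + series v).
  by apply: cvgD; [apply: cvgZl_tmp|]; exact: ell2_dot_cvg.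
apply/funext => N; transitivity (conjc k * (\sum_(0 <= i < N) x i * conjc (y i) ) +
   \sum_(0 <= i < N) x i * conjc (y' i) ) => [|//].
rewrite /series /= mulr_sumr -big_split /=; apply: eq_bigr => i _.
transitivity (x i * conjc (k * y i + y' i)) => //.
by rewrite rmorphD rmorphM mulrDr mulrCA.
Qed.

Lemma normc_ell2_dot x y : normc (ell2_dot x y) <= ell2_norm x * ell2_norm y.
Proof.
apply/ler_addgt0Pr => e e0.
have /cvg_complexP/(_ e e0)[N _ /(_ N (leqnn N)) /= hN] := @ell2_dot_cvg x y.
rewrite -(subrK (series (fun i => x i * conjc (y i) : R[i]^o) N) (ell2_dot x y)).
apply: (le_trans (ler_normcD _ _)); rewrite addrC lerD ?(ltW hN) //.
rewrite seriesEnat /=; apply: (le_trans (normc_sum _ _)).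
apply: le_trans (sum_normc_ell2 x y N); apply: ler_sum => i _.
by rewrite normcM normc_conjc.
Qed.

Lemma ell2_dot_finsupp x y N : (forall i, (N <= i)%N -> x i = 0) ->
  ell2_dot x y = \sum_(0 <= i < N) x i * conjc (y i).
Proof.
move=> x0; apply: ell2_dot_unique; apply: cvg_near_cst; exists N => //= n /= Nn.
rewrite seriesEnat /= (@big_cat_nat _ _ _ N) //= [X in _ + X]big_nat_cond.
by rewrite [X in _ + X]big1 ?addr0 // => i /andP[/andP[Ni _] _]; rewrite x0 // mul0r.
Qed.

End InnerProduct.
(** * Block diagonal operators *)

Section BlockDiagonalAlgebra.
Context {R : realType}.

(** Extends [sum_block] beyond real summands; it is applied to complex ones. *)
Lemma sum_blocks (V : nmodType) (F : nat -> V) (d m : nat) :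
  \sum_(0 <= i < d * m) F i = \sum_(0 <= q < d) \sum_(j < m) F (q * m + j)%N.
Proof.
rewrite big_nat_mul; apply: eq_bigr => q _.
rewrite -{1}[(q * m)%N]add0n big_addn mulSn addnK big_mkord.
by apply: eq_bigr => j _; rewrite addnC.
Qed.

Lemma blockdiagE m (A : 'M[R[i]]_m) (x : nat -> R[i]) q (r : 'I_m) :
  blockdiag A x (q * m + r)%N = \sum_(j < m) A r j * x (q * m + j)%N.
Proof.
have m0 : (0 < m)%N by exact: leq_ltn_trans (ltn_ord r).
apply: eq_bigr => j _; congr (A _ _ * x (_ * _ + _)%N).
  by apply: val_inj; rewrite /= modnMDl modn_small.
by rewrite divnMDl // divn_small ?addn0.
Qed.

Lemma block_ext m (f g : nat -> R[i]) : (0 < m)%N ->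
  (forall q (r : 'I_m), f (q * m + r)%N = g (q * m + r)%N) -> f = g.
Proof.
move=> m0 h; apply/funext => i.
by rewrite (divn_eq i m); exact: (h _ (Ordinal (ltn_pmod i m0))).
Qed.

Lemma phi_linear m (k : R[i]) (A B : 'M[R[i]]_m) :
  phi (k *: A + B) = k *: phi A + phi B.
Proof.
apply: bop_ext => x; apply: val_inj; apply/funext => i.
transitivity (k * blockdiag A x i + blockdiag B x i) => [|//].
rewrite [LHS]/(blockdiag _ x i) /blockdiag.
rewrite mulr_sumr -big_split /=; apply: eq_bigr => j _.
by rewrite !mxE mulrDl mulrA.
Qed.

Lemma phiM m (A B : 'M[R[i]]_m) : (0 < m)%N -> phi (A *m B) = phi A * phi B.
Proof.
move=> m0; apply: bop_ext => x; apply: val_inj; apply: (block_ext m0) => q r.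
transitivity (blockdiag A (blockdiag B x) (q * m + r)) => [|//].
rewrite [LHS]blockdiagE blockdiagE.
under [RHS]eq_bigr do rewrite blockdiagE mulr_sumr.
rewrite exchange_big /=; apply: eq_bigr => j _.
by rewrite mxE mulr_suml; apply: eq_bigr => l _; rewrite mulrA.
Qed.

Lemma phi1 m : (0 < m)%N -> phi (1%:M : 'M[R[i]]_m) = 1.
Proof.
move=> m0; apply: bop_ext => x; apply: val_inj; apply: (block_ext m0) => q r.
transitivity (x (q * m + r)%N) => [|//].
rewrite [LHS]blockdiagE (bigD1 r) //= big1 ?addr0.
  by rewrite mxE eqxx mul1r.
by move=> j jr; rewrite mxE eq_sym (negbTE jr) mul0r.
Qed.

(** The blocks of [diag(A, A, ...)] can be regrouped into larger blocks of [m' / m] copies each.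
    This is what makes the levels increase. *)
Lemma phi_dvd m m' (A : 'M[R[i]]_m) : (0 < m)%N -> (0 < m')%N -> (m %| m')%N ->
  range (@phi R m') (phi A).
Proof.
move=> m0 m'0 /dvdnP[d dE]; pose o i : 'I_m := Ordinal (ltn_pmod i m0).
(* [d] copies of [A] along the diagonal: an entry can be nonzero only if its row and column lie in
   the same [m]-block. *)
exists (\matrix_(r, c) if (r %/ m == c %/ m)%N then A (o r) (o c) else 0) => //.
apply: bop_ext => x; apply: val_inj; apply: (block_ext m'0) => q r.
transitivity (blockdiag A x (q * m' + r)) => [|//]; rewrite [LHS]blockdiagE.
pose F c := (if (r %/ m == c %/ m)%N then A (o r) (o c) else 0) * x (q * m' + c)%N.
transitivity (\sum_(0 <= c < m') F c).
  by rewrite big_mkord; apply: eq_bigr => c _; rewrite mxE.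
have rd : (r %/ m < d)%N by rewrite ltn_divLR // -dE.
(* In terms of [m]-blocks, position [r] of the [q]-th [m']-block is position [o r] of block
   [q * d + r %/ m]. *)
have E : (q * m' + r = (q * d + r %/ m) * m + o r)%N.
  by rewrite /= mulnDl -addnA -divn_eq -mulnA -dE.
rewrite [in RHS]E [in LHS]dE sum_blocks blockdiagE big_mkord (bigD1 (Ordinal rd)) //=.
rewrite [X in _ + X]big1 ?addr0 => [|s sr].
  apply: eq_bigr => j _; rewrite /F divnMDl // (divn_small (ltn_ord j)) addn0 eqxx.
  have -> : o (r %/ m * m + j)%N = j.
    by apply: val_inj; rewrite /= modnMDl modn_small.
  by rewrite mulnDl -mulnA -dE addnA.
apply: big1 => j _; rewrite /F divnMDl // (divn_small (ltn_ord j)) addn0.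
rewrite ifN ?mul0r //; apply: contra sr => /eqP rs.
by apply/eqP/val_inj; rewrite /= rs.
Qed.

End BlockDiagonalAlgebra.
(** * Adjoints *)

Section Adjoint.
Context {R : realType}.
Implicit Types (x y : ell2 R) (S T : bop R).

Lemma sqsum_truncate N (f : nat -> R[i]) :
  sqsum (fun i => if (i < N)%N then f i else 0) =
    (\sum_(0 <= i < N) normc (f i) ^+ 2)%:E.
Proof.
rewrite /sqsum (nneseries_split 0 N) => [|k _]; last by rewrite lee_fin sqr_ge0.
rewrite add0n [X in (_ + X)%E]eseries0 ?adde0 => [|i Ni _]; last first.
  by rewrite ltnNge Ni normc0 expr0n.
rewrite -sumEFin; apply: eq_big_nat => i /andP[_ iN].
by rewrite iN.
Qed.

Lemma square_summable_truncate N (f : nat -> R[i]) :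
  square_summable (fun i => if (i < N)%N then f i else 0).
Proof. by rewrite /square_summable sqsum_truncate ltry. Qed.

(** Accepts any sequence, so that [adj_seq] can be cut off before it is known to be square
    summable. *)
Definition truncate N (f : nat -> R[i]) : ell2 R :=
  Ell2 (square_summable_truncate N f).

Lemma ell2_norm_truncate N f :
  ell2_norm (truncate N f) ^+ 2 = \sum_(0 <= i < N) normc (f i) ^+ 2.
Proof. by apply/EFin_inj; rewrite ell2_normE sqsum_truncate. Qed.

Definition ell2_delta (j : nat) : ell2 R := truncate j.+1 (fun i => (i == j)%:R).

Lemma ell2_deltaE j i : ell2_delta j i = (i == j)%:R.
Proof. by rewrite /=; case: ltnP => // ji; rewrite gtn_eqF. Qed.

Lemma truncateS N f : truncate N.+1 f = f N *: ell2_delta N + truncate N f.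
Proof.
apply: val_inj; apply/funext => i.
transitivity (f N * ell2_delta N i + truncate N f i) => [|//].
rewrite ell2_deltaE /= ltnS leq_eqVlt; case: eqVneq => [->|_] /=.
  by rewrite ltnn mulr1 addr0.
by rewrite mulr0 add0r.
Qed.

Lemma dot_truncate S N f y : ell2_dot (S (truncate N f)) y =
  \sum_(0 <= i < N) f i * ell2_dot (S (ell2_delta i)) y.
Proof.
elim: N => [|N IH].
  have -> : truncate 0 f = 0 by apply: val_inj; apply/funext.
  rewrite linear0 big_nil (@ell2_dot_finsupp _ _ _ 0) ?big_nil //.
by rewrite truncateS linearP ell2_dot_linearl IH big_nat_recr //= addrC.
Qed.

(** The squared norm of the remainder is a tail of the convergent series [sqsum x]. *)
Lemma truncate_cvg x (e : R) : 0 < e ->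
  \forall N \near \oo, ell2_norm (x - truncate N x) < e.
Proof.
move=> e0; have x0 i : (0 <= (normc (x i) ^+ 2)%:E)%E by rewrite lee_fin sqr_ge0.
have : (sqsum x < +oo)%E by rewrite -ell2_normE ltry.
move=> /nneseries_tail_cvg/(_ (fun i _ => x0 i)) => h.
have e20 : ((0 : \bar R) < (e ^+ 2)%:E)%E by rewrite lte_fin exprn_gt0.
have H : \forall N \near \oo,
    (\sum_(N <= k <oo) (normc (x k) ^+ 2)%:E < (e ^+ 2)%:E)%E.
  exact: h _ (open_nbhs_nbhs (conj (@open_ereal_lt_ereal R (e ^+ 2)%:E) e20)).
apply: filterS H => N /=.
suff -> : (\sum_(N <= k <oo) (normc (x k) ^+ 2)%:E)%E =
    (ell2_norm (x - truncate N x) ^+ 2)%:E.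
  by rewrite lte_fin ltr_pXn2r ?nnegrE ?ell2_norm_ge0 ?ltW.
rewrite ell2_normE /sqsum (nneseries_split 0 N) => [|k _]; last first.
  by rewrite lee_fin sqr_ge0.
have E i : (x - truncate N x) i = if (i < N)%N then 0 else x i.
  transitivity (x i - truncate N x i) => //=.
  by case: ifP; rewrite ?subrr ?subr0.
rewrite add0n [X in (X + _)%E]big1_seq ?add0e => [|i]; last first.
  rewrite mem_index_iota => /and3P[_ _ iN]; by rewrite E iN normc0 expr0n.
rewrite [LHS]eseries_cond [RHS]eseries_cond; apply: eq_eseriesr => i Ni.
by move: Ni; rewrite andTb E ltnNge => ->.
Qed.

(** These coordinates are forced by [<S e_i, y> = <e_i, S^* y>], the product being conjugate-linear
    in its second argument. *)
Definition adj_seq S y : nat -> R[i] :=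
  fun i => conjc (ell2_dot (S (ell2_delta i)) y).

(** Duality: for the truncation [t] of the sequence itself, [ell2_dot (S t) y] is the squared norm
    of [t], while Cauchy-Schwarz bounds it by [opnorm S * ell2_norm t * ell2_norm y]. Cancelling one
    norm of [t] bounds every partial sum. *)
Lemma sqsum_adj_seq S y :
  (sqsum (adj_seq S y) <= ((opnorm S * ell2_norm y) ^+ 2)%:E)%E.
Proof.
apply: lime_le.
  by apply: is_cvg_nneseries => i _ _; rewrite lee_fin sqr_ge0.
apply: nearW => N; rewrite sumEFin lee_fin -ell2_norm_truncate.
set t := truncate N _.
rewrite ler_pXn2r ?nnegrE ?mulr_ge0 ?opnorm_ge0 ?ell2_norm_ge0 //.
have [->|t0] := eqVneq (ell2_norm t) 0.
  by rewrite mulr_ge0 ?opnorm_ge0 ?ell2_norm_ge0.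
have {}t0 : 0 < ell2_norm t by rewrite lt0r t0 ell2_norm_ge0.
rewrite -(ler_pM2r t0) -expr2.
have : ell2_dot (S t) y = (ell2_norm t ^+ 2)%:C.
  rewrite dot_truncate ell2_norm_truncate rmorph_sum; apply: eq_bigr => i _.
  rewrite /adj_seq; case: (ell2_dot _ _) => a b /=.
  rewrite sqrrN sqr_sqrtr ?addr_ge0 ?sqr_ge0 //.
  by apply/eqP; rewrite eq_complex /= mulNr opprK !expr2 eqxx /= mulrC mulNr subrr.
move=> /(congr1 (@normc R)); rewrite /= expr0n addr0 sqrtr_sqr.
rewrite ger0_norm ?sqr_ge0 // => <-.
apply: (le_trans (normc_ell2_dot _ _)).
by rewrite mulrAC ler_wpM2r ?ell2_norm_ge0 ?ell2_norm_bop.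
Qed.

Lemma square_summable_adj S y : square_summable (adj_seq S y).
Proof. by apply: (le_lt_trans (sqsum_adj_seq S y)); rewrite ltry. Qed.

Lemma ell2_norm_adj S y :
  ell2_norm (Ell2 (square_summable_adj S y)) <= opnorm S * ell2_norm y.
Proof.
by rewrite ell2_norm_le ?mulr_ge0 ?opnorm_ge0 ?ell2_norm_ge0 // sqsum_adj_seq.
Qed.

Lemma bounded_linear_adj S :
  `[< bounded_linear (fun y => Ell2 (square_summable_adj S y)) >].
Proof.
apply/asboolP; split; last by exists (opnorm S) => y; exact: ell2_norm_adj.
move=> k y y'; apply: val_inj; apply/funext => i.
transitivity (k * adj_seq S y i + adj_seq S y' i) => [|//].
rewrite /= /adj_seq ell2_dot_linearr rmorphD rmorphM.
by congr (_ * _ + _); exact: conjcK.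
Qed.

Definition adj S : bop R := Bop (bounded_linear_adj S).

Lemma adjE S y i : adj S y i = conjc (ell2_dot (S (ell2_delta i)) y).
Proof. by []. Qed.

Lemma opnorm_adj S : opnorm (adj S) <= opnorm S.
Proof. by apply: opnorm_le => [|y]; [exact: opnorm_ge0|exact: ell2_norm_adj]. Qed.

Lemma adjB S T : adj (S - T) = adj S - adj T.
Proof.
apply: bop_ext => y; apply: val_inj; apply/funext => i.
transitivity (adj S y i - adj T y i) => [|//]; rewrite !adjE.
transitivity (conjc (ell2_dot (-1 *: T (ell2_delta i) + S (ell2_delta i)) y)).
  by rewrite scaleN1r addrC.
by rewrite ell2_dot_linearl mulN1r rmorphD rmorphN addrC.
Qed.

(** The partial sums of [ell2_dot x (adj S y)] are [ell2_dot (S (truncate N x)) y], and these tend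
    to [ell2_dot (S x) y] because [S] is bounded. *)
Lemma is_adjoint_adj S : is_adjoint S (adj S).
Proof.
move=> x y; apply/esym/ell2_dot_unique/cvg_complexP => e e0.
(* The [+ 1] keeps the divisor in [e / M] positive. *)
pose M := opnorm S * ell2_norm y + 1.
have M0 : 0 < M by rewrite ltr_wpDl // mulr_ge0 ?opnorm_ge0 ?ell2_norm_ge0.
have := @truncate_cvg x (e / M) (divr_gt0 e0 M0); apply: filterS => N hN.
have -> : series (fun i => x i * conjc (adj S y i) : R[i]^o) N =
    ell2_dot (S (truncate N x)) y.
  by rewrite dot_truncate seriesEnat; apply: eq_bigr => i _; rewrite adjE conjcK.
have -> : ell2_dot (S x) y - ell2_dot (S (truncate N x)) y =
    ell2_dot (S (x - truncate N x)) y.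
  rewrite -scaleN1r addrC -(scaleN1r (truncate N x)) addrC (addrC x).
  by rewrite linearP ell2_dot_linearl mulN1r addrC scaleN1r.
apply: (le_lt_trans (normc_ell2_dot _ _)).
apply: (@le_lt_trans _ _ (M * ell2_norm (x - truncate N x))); last first.
  by rewrite mulrC -ltr_pdivlMr.
apply: (@le_trans _ _ (opnorm S * ell2_norm (x - truncate N x) * ell2_norm y)).
  by rewrite ler_wpM2r ?ell2_norm_ge0 ?ell2_norm_bop.
by rewrite mulrAC ler_wpM2r ?ell2_norm_ge0 // lerDl.
Qed.

(** Column [i] of [phi A] is supported in the block containing [i], so each coordinate of the
    adjoint is a finite sum over one block. *)
Lemma adj_phi m (A : 'M[R[i]]_m) : (0 < m)%N ->
  adj (phi A) = phi (\matrix_(i, j) conjc (A j i)).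
Proof.
move=> m0; apply: bop_ext => y; apply: val_inj; apply: (block_ext m0) => q r.
pose i := (q * m + r)%N.
transitivity (blockdiag (\matrix_(i, j) conjc (A j i)) y i) => [|//].
transitivity (conjc (ell2_dot (phi A (ell2_delta i)) y)); first exact: adjE.
have col q' (s : 'I_m) : phi A (ell2_delta i) (q' * m + s)%N =
    if q' == q then A s r else 0.
  transitivity (blockdiag A (ell2_delta i) (q' * m + s)) => //.
  rewrite blockdiagE; under eq_bigr do rewrite ell2_deltaE.
  (* Uniqueness of quotient and remainder modulo [m]. *)
  have E (j : 'I_m) : (q' * m + j == i)%N = (q' == q) && (j == r).
    apply/eqP/andP => [jE|[/eqP -> /eqP ->] //].
    have := congr1 (modn^~ m) jE; have := congr1 (divn^~ m) jE.
    rewrite /i !divnMDl // !(divn_small (ltn_ord _)) !addn0 => ->.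
    rewrite !modnMDl !modn_small // => /val_inj ->.
    by rewrite !eqxx.
  under eq_bigr do rewrite E.
  case: eqVneq => _ /=; last by apply: big1 => j _; rewrite mulr0.
  rewrite (bigD1 r) //= eqxx mulr1 big1 ?addr0 // => j /negbTE ->.
  by rewrite mulr0.
rewrite (@ell2_dot_finsupp _ _ _ (q.+1 * m)) => [|l ql]; last first.
  rewrite (divn_eq l m) (col _ (Ordinal (ltn_pmod l m0))) ifN //.
  by rewrite gtn_eqF // leq_divRL.
rewrite sum_blocks; under eq_bigr do under eq_bigr do rewrite col.
rewrite big_nat_recr //= big_nat_cond big1 ?add0r; last first.
  move=> q' /andP[/andP[_ q'q] _]; apply: big1 => s _.
  by rewrite ltn_eqF // mul0r.
rewrite /i blockdiagE eqxx rmorph_sum; apply: eq_bigr => s _.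
by rewrite rmorphM /= conjcK mxE.
Qed.

End Adjoint.

(** * Signs and positivity of the operator norm *)

Section Opnorm.
Context {R : realType}.
Implicit Types S T : bop R.

Lemma opnorm0 : opnorm (0 : bop R) = 0.
Proof. by rewrite -(scale0r (0 : bop R)) opnormZ normc0 mul0r. Qed.

Lemma opnormN T : opnorm (- T) = opnorm T.
Proof. by rewrite -scaleN1r opnormZ normcN normc1 mul1r. Qed.

Lemma opnormB S T : opnorm (S - T) = opnorm (T - S).
Proof. by rewrite -opprB opnormN. Qed.

Lemma opnorm_gt0 T : T != 0 -> 0 < opnorm T.
Proof.
rewrite lt0r opnorm_ge0 andbT; apply: contra_neq => /opnorm0_eq0.
by [].
Qed.

End Opnorm.

(** * Approximation errors *)

Section ApproximationErrors.
Context {R : realType} {n : nat -> nat}.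
Hypothesis n_gt0 : forall k, (1 <= k)%N -> (0 < n k)%N.
Hypothesis n_dvd : forall k, (1 <= k)%N -> (n k %| n k.+1)%N.
Implicit Types (a b c x y z : bop R) (k : nat).

Local Notation X := (@uhf_level R n).
Local Notation E := (@approx_err R n).

Lemma uhf_level_linear k (s : R[i]) x y : X k x -> X k y -> X k (s *: x + y).
Proof.
case: k => [|k] /= => [-> ->|[A _ <-] [B _ <-]].
  by rewrite /= scaler0 addr0.
by exists (s *: A + B) => //; rewrite phi_linear.
Qed.

Lemma uhf_level0 k : X k 0.
Proof.
case: k => [//|k]; exists 0 => //.
(* Linearity with coefficient [-1] at zero matrices gives [phi 0 = - phi 0 + phi 0]. *)
have := phi_linear (-1) (0 : 'M[R[i]]_(n k.+1)) 0.
by rewrite scaler0 addr0 scaleN1r addNr.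
Qed.

Lemma uhf_levelM k x y : X k x -> X k y -> X k (x * y).
Proof.
case: k => [-> _|k [A _ <-] [B _ <-]]; first by rewrite mul0r.
by exists (A *m B) => //; rewrite phiM // n_gt0.
Qed.

Lemma uhf_level_adj k x : X k x -> X k (adj x).
Proof.
case: k => [->|k [A _ <-]].
  by rewrite -(subrr (0 : bop R)) adjB subrr.
by eexists; last by rewrite adj_phi // n_gt0.
Qed.

Lemma uhf_level_mono k k' x : (k <= k')%N -> X k x -> X k' x.
Proof.
case: k => [_ ->|k]; first exact: uhf_level0.
case: k' => // k' kk' [A _ <-]; apply: phi_dvd; rewrite ?n_gt0 //.
rewrite ltnS in kk'; rewrite -(subnK kk').
elim: (k' - k)%N => [//|d IH]; rewrite addSn.
by apply: (dvdn_trans IH); exact: n_dvd.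
Qed.

(** Together with [err_set_lb], this makes the [inf] in [approx_err] a true infimum rather than a
    default value. *)
Let err_set_neq0 k a : [set opnorm (a - x) | x in X k] !=set0.
Proof. by exists (opnorm (a - 0)), 0 => //; exact: uhf_level0. Qed.

Let err_set_lb k a : has_lbound [set opnorm (a - x) | x in X k].
Proof. by exists 0 => _ [x _ <-]; exact: opnorm_ge0. Qed.

Lemma approx_err_ge0 k a : 0 <= E k a.
Proof. by apply: lb_le_inf => // _ [x _ <-]; exact: opnorm_ge0. Qed.

Lemma approx_err_le k a x : X k x -> E k a <= opnorm (a - x).
Proof. by move=> Xx; apply: ge_inf => //; exists x. Qed.

Lemma approx_err_lt k a e : E k a < e -> exists2 x, X k x & opnorm (a - x) < e.
Proof.
rewrite -subr_gt0 => /inf_adherent/(_ (conj (err_set_neq0 k a) (err_set_lb k a))).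
by rewrite addrC subrK => -[_ [x Xx <-]]; exists x.
Qed.

Lemma approx_err_level k x : X k x -> E k x = 0.
Proof.
move=> Xx; apply/eqP; rewrite eq_le approx_err_ge0 andbT.
by rewrite -opnorm0 -(subrr x) approx_err_le.
Qed.

(** Transfers an estimate between individual approximants to the distances, by choosing [x] and [y]
    within [d] of the infima. *)
Lemma approx_err_dom k (C : R) a b c : 0 <= C ->
  (forall x y, X k x -> X k y ->
    exists2 z, X k z & opnorm (c - z) <= C * (opnorm (a - x) + opnorm (b - y))) ->
  E k c <= C * (E k a + E k b).
Proof.
move=> C0 h; apply/ler_addgt0Pr => e e0.
have C10 : 0 < C + 1 by rewrite ltr_wpDl.
(* Makes the total loss [C * (d + d)] at most [e], also when [C] is [0]. *)
pose d := e / (C + 1) / 2.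
have d0 : 0 < d by rewrite !divr_gt0.
have [x Xx xd] : exists2 x, X k x & opnorm (a - x) < E k a + d.
  by apply: approx_err_lt; rewrite ltrDl.
have [y Xy yd] : exists2 y, X k y & opnorm (b - y) < E k b + d.
  by apply: approx_err_lt; rewrite ltrDl.
have [z Xz hz] := h _ _ Xx Xy.
apply: (le_trans (approx_err_le _ Xz)); apply: (le_trans hz).
apply: (@le_trans _ _ (C * (E k a + d + (E k b + d)))).
  by exact: ler_wpM2l C0 _ _ (lerD (ltW xd) (ltW yd)).
rewrite addrACA mulrDr lerD2l -splitr mulrCA ler_piMr ?(ltW e0) //.
by rewrite ler_pdivrMr // mul1r lerDl.
Qed.

Lemma approx_err_linear k (s : R[i]) a b :
  E k (s *: a + b) <= (normc s + 1) * (E k a + E k b).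
Proof.
apply: approx_err_dom => [|x y Xx Xy]; first by rewrite addr_ge0 ?normc_ge0.
exists (s *: x + y); first exact: uhf_level_linear.
rewrite opprD addrACA -scalerBr; apply: (le_trans (ler_opnormD _ _)).
rewrite opnormZ; have := opnorm_ge0 (a - x); have := opnorm_ge0 (b - y).
by have := normc_ge0 s; nra.
Qed.

(** In [a * b - x * y = a * (b - y) + (a - x) * y], the first term contributes [opnorm a] and the
    second [2 * opnorm b], once [y] is not too large. *)
Lemma approx_errM k a b :
  E k (a * b) <= (opnorm a + 2 * opnorm b) * (E k a + E k b).
Proof.
have a0 := opnorm_ge0 a; have b0 := opnorm_ge0 b.
apply: approx_err_dom => [|x y Xx Xy]; first by rewrite addr_ge0 ?mulr_ge0.
have ax0 := opnorm_ge0 (a - x); have by0 := opnorm_ge0 (b - y).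
have [yb|yb] := leP (opnorm y) (2 * opnorm b).
  exists (x * y); first exact: uhf_levelM.
  have -> : a * b - x * y = a * (b - y) + (a - x) * y.
    by rewrite mulrBr mulrBl addrA subrK.
  apply: (le_trans (ler_opnormD _ _)).
  have := ler_opnormM a (b - y); have := ler_opnormM (a - x) y.
  by have := opnorm_ge0 y; nra.
(* Here [opnorm (b - y) > opnorm b], so [opnorm a * opnorm (b - y)] already dominates the norm of
   [a * b]. *)
exists 0; rewrite ?subr0; first exact: uhf_level0.
have := ler_opnormM a b.
have := ler_opnormD (y - b) b; rewrite subrK opnormB.
by nra.
Qed.

Lemma approx_err_adj k a : E k (adj a) <= E k a.
Proof.
apply/ler_addgt0Pr => e e0.
have [x Xx xd] : exists2 x, X k x & opnorm (a - x) < E k a + e.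
  by apply: approx_err_lt; rewrite ltrDl.
apply: (le_trans (approx_err_le _ (uhf_level_adj Xx))).
by rewrite -adjB (le_trans (opnorm_adj _)) // ltW.
Qed.

(* If [x] is so close to [a] that it is bounded below, then it is an invertible
   matrix; otherwise [0] is a good enough approximation of the inverse. *)
Lemma approx_err_inv k a b : a * b = 1 -> b * a = 1 ->
  E k b <= 2 * opnorm b ^+ 2 * E k a.
Proof.
move=> ab ba.
have b0 : 0 < opnorm b.
  apply: opnorm_gt0; apply/eqP => b0; move: ba; rewrite b0 mul0r.
  by move/esym/eqP; rewrite oner_eq0.
(* [approx_err_dom] expects two elements; the second is [0], whose error vanishes. *)
rewrite -[E k a]addr0 -(approx_err_level (uhf_level0 k)).
apply: approx_err_dom => [|x y Xx _]; first by rewrite mulr_ge0 ?sqr_ge0.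
have ax0 := opnorm_ge0 (a - x); have by0 := opnorm_ge0 (0 - y).
suff [z Xz hz] : exists2 z, X k z & opnorm (b - z) <= 2 * opnorm b ^+ 2 * opnorm (a - x).
  exists z => //; apply: (le_trans hz); rewrite ler_wpM2l ?mulr_ge0 ?(ltW b0) //.
  by rewrite lerDl.
have [far|near] := leP 1 (2 * opnorm b * opnorm (a - x)).
  exists 0; rewrite ?subr0; first exact: uhf_level0.
  have -> : 2 * opnorm b ^+ 2 * opnorm (a - x) =
      2 * opnorm b * opnorm (a - x) * opnorm b by ring.
  by rewrite ler_peMl // ltW.
(* From [v = b (a v)] and [a v = x v + (a - x) v]; the closeness of [x] to [a] lets half of
   [ell2_norm v] be absorbed on the left. *)
have below v : ell2_norm v <= 2 * opnorm b * ell2_norm (x v).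
  have E1 : b (a v) = v.
    by transitivity ((b * a) v) => //; rewrite ba.
  have h1 : ell2_norm v <= opnorm b * ell2_norm (a v).
    by rewrite -{1}E1 ell2_norm_bop.
  have h2 : ell2_norm (a v) <= ell2_norm (x v) + opnorm (a - x) * ell2_norm v.
    rewrite -[a v](subrK (x v)) addrC (le_trans (ler_ell2_normD _ _)) // lerD2l.
    exact: (ell2_norm_bop (a - x) v).
  have v0 := ell2_norm_ge0 v.
  have h3 : 2 * (opnorm b * ell2_norm (a v)) <=
      2 * opnorm b * ell2_norm (x v) + 2 * opnorm b * opnorm (a - x) * ell2_norm v.
    by nra.
  have h4 : 2 * opnorm b * opnorm (a - x) * ell2_norm v <= ell2_norm v.
    by rewrite ler_piMl // ltW.
  by lra.
(* At level [0], [x = 0] contradicts the lower bound at a unit vector. *)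
case: k Xx => [x0|k [A _ xA]].
  have := below (ell2_delta 0); rewrite x0.
  have -> : (0 : bop R) (ell2_delta 0) = 0 by [].
  rewrite ell2_norm0 mulr0 leNgt => /negP[].
  rewrite lt0r ell2_norm_ge0 andbT; apply/eqP => /ell2_norm0_eq0.
  move=> /(congr1 (fun v : ell2 R => v 0%N)).
  by rewrite ell2_deltaE eqxx => /eqP; rewrite oner_eq0.
have m0 := n_gt0 (ltn0Sn k).
have uA : A \in unitmx.
  rewrite -unitmx_tr -row_free_unit; apply/inj_row_free => v vA.
  pose m := n k.+1.
  (* A kernel vector of [A], padded by zeros to fill only block [0], lies in the kernel of [x] and
     so vanishes by [below]. *)
  pose f i := if insub i is Some j then v 0 (j : 'I_m) else 0.
  have fE (j : 'I_m) : f j = v 0 j by rewrite /f valK.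
  have : x (truncate m f) = 0.
    rewrite -xA; apply: val_inj; apply: (block_ext m0) => q r.
    transitivity (blockdiag A (truncate m f) (q * m + r)) => [//|].
    rewrite blockdiagE; case: q => [|q].
      transitivity ((v *m A^T) 0 r); last by rewrite vA mxE.
      rewrite mxE; apply: eq_bigr => j _.
      by rewrite /= mul0n add0n ltn_ord fE mxE mulrC.
    apply: big1 => j _; rewrite /= ifN ?mulr0 // -leqNgt.
    by rewrite mulSn -addnA leq_addr.
  move=> xf; have := below (truncate m f).
  rewrite xf ell2_norm0 mulr0 => f0.
  have /ell2_norm0_eq0 tf : ell2_norm (truncate m f) = 0.
    by apply/eqP; rewrite eq_le f0 ell2_norm_ge0.
  apply/rowP => j; rewrite -fE mxE.
  have := congr1 (fun u : ell2 R => u j) tf.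
  by rewrite /= ltn_ord.
pose z := phi (invmx A).
have xz : x * z = 1 by rewrite -xA -phiM // mulmxV // phi1.
have nz : opnorm z <= 2 * opnorm b.
  apply: opnorm_le => [|v]; first by rewrite mulr_ge0 ?ltW.
  have := below (z v).
  by have -> : x (z v) = v by transitivity ((x * z) v) => //; rewrite xz.
exists z; first by exists (invmx A).
(* Second resolvent identity, from [b * a = 1] and [x * z = 1]. *)
have -> : b - z = b * (x - a) * z.
  by rewrite mulrBr mulrBl ba mul1r -mulrA xz mulr1.
apply: (le_trans (ler_opnormM _ _)).
have := ler_opnormM b (x - a); rewrite (opnormB x a) => h.
have := opnorm_ge0 z; have := opnorm_ge0 (b * (x - a)) => h0 h1.
apply: (@le_trans _ _ (opnorm b * opnorm (a - x) * (2 * opnorm b))).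
  by rewrite ler_pM.
by rewrite le_eqVlt; apply/orP; left; apply/eqP; ring.
Qed.

End ApproximationErrors.

(** * Weighted power sums *)

(** The sum is at most twice its larger term, which by symmetry may be taken to be [t]. *)
Lemma powR_sum_le (R : realType) (r s t : R) : 0 <= r -> 0 <= s -> 0 <= t ->
  (s + t) `^ r <= 2 `^ r * (s `^ r + t `^ r).
Proof.
move=> r0; wlog st : s t / s <= t.
  move=> H s0 t0; have [st|/ltW ts] := leP s t; first exact: H.
  by rewrite addrC [X in _ * X]addrC; exact: H.
move=> s0 t0; apply: (@le_trans _ _ ((2 * t) `^ r)).
  by apply: ge0_ler_powR; rewrite ?nnegrE ?addr_ge0 ?mulr_ge0 // mulrDl mul1r lerD2r.
by rewrite powRM // ler_wpM2l ?powR_ge0 // lerDr powR_ge0.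
Qed.

(** Only finiteness has to be transferred, so a termwise bound with the crude constant [C]^ r * 2
    [^ r] replaces Minkowski's inequality. *)
Lemma powR_series_dom (R : realType) (r C : R) (w s t u : nat -> R) :
  0 < r -> 0 <= C -> (forall k, 0 <= s k) -> (forall k, 0 <= t k) ->
  (forall k, 0 <= u k) -> (forall k, u k <= C * (s k + t k)) ->
  (\sum_(0 <= k <oo) (s k `^ r * w k `^ r)%:E < +oo)%E ->
  (\sum_(0 <= k <oo) (t k `^ r * w k `^ r)%:E < +oo)%E ->
  (\sum_(0 <= k <oo) (u k `^ r * w k `^ r)%:E < +oo)%E.
Proof.
move=> r0 C0 s0 t0 u0 ust fs ft.
have p0 (f : nat -> R) k : true -> (0 <= (f k `^ r * w k `^ r)%:E)%E.
  by rewrite lee_fin mulr_ge0 ?powR_ge0.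
pose D := C `^ r * 2 `^ r.
have D0 : 0 <= D by rewrite mulr_ge0 ?powR_ge0.
apply: (@le_lt_trans _ _ (\sum_(0 <= k <oo)
   (D%:E * (s k `^ r * w k `^ r)%:E + D%:E * (t k `^ r * w k `^ r)%:E))%E).
  apply: lee_nneseries => [k _|k _]; first exact: p0.
  rewrite -!EFinM -EFinD lee_fin -mulrDr -mulrDl mulrA.
  rewrite ler_wpM2r ?powR_ge0 //; apply: (@le_trans _ _ ((C * (s k + t k)) `^ r)).
    by apply: ge0_ler_powR; rewrite ?nnegrE ?mulr_ge0 ?addr_ge0 ?(ltW r0).
  rewrite powRM ?addr_ge0 // /D -mulrA ler_wpM2l ?powR_ge0 //.
  by apply: powR_sum_le; rewrite ?(ltW r0).
rewrite nneseriesD; last 2 first.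
- by move=> k _ _; rewrite mule_ge0 ?p0 // lee_fin.
- by move=> k _ _; rewrite mule_ge0 ?p0 // lee_fin.
by rewrite !nneseriesZl ?lte_add_pinfty ?lte_mul_pinfty // => k; exact: p0.
Qed.

(** * The approximation space *)

Section ApproximationSpace.
Context {R : realType} {n : nat -> nat}.
Hypothesis n_gt0 : forall k, (1 <= k)%N -> (0 < n k)%N.
Hypothesis n_dvd : forall k, (1 <= k)%N -> (n k %| n k.+1)%N.
Variables (p : \bar R) (w : nat -> R).
Hypothesis p_ge1 : (1 <= p)%E.
Hypothesis w_gt0 : forall k, 0 < w k.
Implicit Types (a b c x y z : bop R) (k : nat).

Local Notation X := (@uhf_level R n).
Local Notation E := (@approx_err R n).
Local Notation approx := (approx_space n p w).

Lemma approx_err_mono k k' a : (k <= k')%N -> E k' a <= E k a.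
Proof.
move=> kk'; apply/ler_addgt0Pr => e e0.
have [x Xx xd] : exists2 x, X k x & opnorm (a - x) < E k a + e.
  by apply: approx_err_lt; rewrite ltrDl.
apply: (le_trans (approx_err_le _ (uhf_level_mono n_gt0 n_dvd kk' Xx))).
exact: ltW xd.
Qed.

Lemma UHF_approx_errP a :
  UHF n a <-> forall e : R, 0 < e -> exists2 k, (1 <= k)%N & E k a < e.
Proof.
split=> [Ua e e0|h B /nbhs_ballP[e e0 eB]].
  have : nbhs a (ball a e%:C).
    by apply: nbhsx_ballx; rewrite ltcR.
  move=> /Ua[x [[k k0 Xx]]]; rewrite -ball_normE /= bop_normE ltcR => xd.
  exists k => //; apply: le_lt_trans xd; apply: approx_err_le.
  by case: k k0 Xx.
(* The radius [e] lives in [R[i]]; its positivity makes it real, and its real part is the tolerance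
   passed to [h]. *)
have /andP[_ e0'] : (complex.Im e == 0) && (0 < complex.Re e).
  by move: e0; rewrite /= ltcE /= eq_sym.
have [k k1 /approx_err_lt[x Xx xd]] := h _ e0'.
exists x; split; first by exists k => //; case: k k1 Xx.
apply: eB; rewrite -ball_normE /= bop_normE ltcE /= xd andbT.
by move: e0; rewrite /= ltcE => /andP[].
Qed.

Lemma UHF_dom (C : R) a b c : 0 <= C -> UHF n a -> UHF n b ->
  (forall k, E k c <= C * (E k a + E k b)) -> UHF n c.
Proof.
move=> C0 /UHF_approx_errP Ua /UHF_approx_errP Ub h; apply/UHF_approx_errP => e e0.
have C10 : 0 < C + 1 by rewrite ltr_wpDl.
have d0 : 0 < e / (C + 1) / 2 by rewrite !divr_gt0.
have [k k1 ka] := Ua _ d0; have [l l1 lb] := Ub _ d0.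
(* Errors do not increase with the level, so both are small at the larger index. *)
exists (maxn k l); first by rewrite leq_max k1.
apply: (le_lt_trans (h _)).
have {}ka := le_lt_trans (approx_err_mono a (leq_maxl k l)) ka.
have {}lb := le_lt_trans (approx_err_mono b (leq_maxr k l)) lb.
apply: (@le_lt_trans _ _ (C * (e / (C + 1)))).
  by apply: ler_wpM2l => //; rewrite [leRHS]splitr; exact: lerD (ltW ka) (ltW lb).
by rewrite mulrCA gtr_pMr // ltr_pdivrMr // mul1r ltrDl.
Qed.

Lemma approx_norm_dom (C : R) a b c : 0 <= C ->
  (forall k, E k c <= C * (E k a + E k b)) ->
  (approx_norm n p w a < +oo)%E -> (approx_norm n p w b < +oo)%E ->
  (approx_norm n p w c < +oo)%E.
Proof.
have E0 k x : 0 <= E k x by exact: approx_err_ge0.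
move=> C0 h; case: p p_ge1 => [r r1| _|//] /=; last first.
  have bound x : (ereal_sup (range (fun k => (E k x * w k)%:E)) < +oo)%E ->
      exists M : R, forall k, E k x * w k <= M.
    set s := ereal_sup _ => sy.
    have le k : ((E k x * w k)%:E <= s)%E.
      by apply: ereal_sup_ubound; exists k.
    (* [s] is a finite number: it is below [+oo] and at least the nonnegative term of index [0]. *)
    exists (fine s) => k; rewrite -lee_fin fineK //.
    rewrite ge0_fin_numE //; apply: le_trans (le 0%N).
    by rewrite lee_fin mulr_ge0 // ltW.
  move=> /bound[M hM] /bound[N hN].
  apply: (@le_lt_trans _ _ (C * (M + N))%:E); last exact: ltry.
  apply: ge_ereal_sup => _ [k _ <-]; rewrite lee_fin.
  apply: (@le_trans _ _ (C * (E k a + E k b) * w k)).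
    by rewrite ler_wpM2r ?(ltW (w_gt0 k)).
  by rewrite -mulrA mulrDl ler_wpM2l // lerD.
rewrite lee_fin in r1; have r0 : 0 < r by exact: lt_le_trans ltr01 r1.
have rV0 : r^-1 != 0 by rewrite invr_neq0 // gt_eqF.
(* Finiteness passes through the outer exponent [r^-1] in both directions, leaving the bare
   series. *)
move=> /(lty_poweRy rV0) sa /(lty_poweRy rV0) sb; apply: poweR_lty.
by apply: powR_series_dom sa sb; [|exact: C0|..].
Qed.

Lemma approx_space_dom (C : R) a b c : 0 <= C -> approx a -> approx b ->
  (forall k, E k c <= C * (E k a + E k b)) -> approx c.
Proof.
move=> C0 [Ua na] [Ub nb] h.
by split; [exact: UHF_dom C0 Ua Ub h|exact: approx_norm_dom C0 h na nb].
Qed.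

Lemma uhf_level_approx_space k x : (1 <= k)%N -> X k x -> approx x.
Proof.
move=> k1 Xx; split.
  by apply: subset_closure; exists k => //; case: k k1 Xx.
have Ex l : (k <= l)%N -> E l x = 0.
  by move=> kl; apply/approx_err_level/(uhf_level_mono n_gt0 n_dvd kl Xx).
have E0 l : 0 <= E l x by exact: approx_err_ge0.
case: p p_ge1 => [r r1| _|//] /=; last first.
  (* The sum of the nonnegative terms of index below [k] bounds each of them. *)
  apply: (@le_lt_trans _ _ (\sum_(0 <= l < k) E l x * w l)%:E); last exact: ltry.
  have t0 l : 0 <= E l x * w l by rewrite mulr_ge0 // ltW.
  apply: ge_ereal_sup => _ [l _ <-]; rewrite lee_fin.
  have [kl|lk] := leqP k l; first by rewrite Ex // mul0r sumr_ge0.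
  by rewrite big_mkord (bigD1 (Ordinal lk)) //= lerDl sumr_ge0.
rewrite lee_fin in r1.
(* With exponent [0] the power of a vanishing error would be [1], and the tail would not vanish. *)
have r0 : r != 0 by rewrite gt_eqF // (lt_le_trans ltr01 r1).
apply: poweR_lty; rewrite (nneseries_split 0 k) => [|l _]; last first.
  by rewrite lee_fin mulr_ge0 ?powR_ge0.
rewrite add0n [X in (_ + X)%E]eseries0 => [|l kl _]; last by rewrite Ex // powR0 // mul0r.
by rewrite adde0 sumEFin ltry.
Qed.

End ApproximationSpace.

Theorem corollary4p6 (R : realType) (n : nat -> nat)
    (n_gt0 : forall k, (1 <= k)%N -> (0 < n k)%N)
    (n_dvd : forall k, (1 <= k)%N -> (n k %| n k.+1)%N)
    (n_lim : n @ \oo --> \oo)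
    (p : \bar R) (p_ge1 : (1 <= p)%E)
    (w : nat -> R) (w_gt0 : forall k, 0 < w k) :
  [/\ unital_star_subalgebra (approx_space n p w) (UHF n),
      dense_in (approx_space n p w) (UHF n) &
      inverse_closed (approx_space n p w) (UHF n)].
Proof.
have dom := approx_space_dom n_gt0 n_dvd p_ge1 w_gt0.
have lvl := @uhf_level_approx_space _ _ n_gt0 n_dvd _ _ p_ge1 w_gt0.
have sub : (approx_space n p w `<=` UHF n)%classic by move=> a [].
split; last 2 first.
(* Every level from [1] on lies in the space, so the closure of their union lies in its closure. *)
- split=> //; apply: closure_subset => x [k k1 Xx].
  by apply: (lvl k) => //; case: k k1 Xx.
- move=> a b Aa Ub ab ba.
  have Eb k := approx_err_inv n_gt0 k ab ba.
  have C0 : 0 <= 2 * opnorm b ^+ 2 by rewrite mulr_ge0 ?exprn_ge0 ?opnorm_ge0.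
  (* Taking [a] in both slots of [dom] only enlarges the bound. *)
  apply: (dom _ a a b C0) => // k; apply: (le_trans (Eb k)).
  by rewrite ler_wpM2l // lerDl approx_err_ge0.
split=> //; last first.
  move=> S AS; exists (adj S); last exact: is_adjoint_adj.
  apply: (dom 1 S S) => // k; rewrite mul1r.
  apply: (le_trans (approx_err_adj n_gt0 k S)).
  by rewrite lerDl approx_err_ge0.
split=> [|s a b /set_mem Aa /set_mem Ab|a b /set_mem Aa /set_mem Ab]; apply/mem_set.
(* Level [0] is [{0}], so the unit is taken from level [1]. *)
- by apply: (lvl 1%N) => //; exists 1%:M => //; rewrite phi1 // n_gt0.
- apply: (dom (normc s + 1) a b _ _ Aa Ab) => [|k]; last exact: approx_err_linear.
  by rewrite addr_ge0 // normc_ge0.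
- have C0 : 0 <= opnorm a + 2 * opnorm b by rewrite addr_ge0 ?mulr_ge0 ?opnorm_ge0.
  by apply: (dom _ a b _ C0 Aa Ab) => k; exact: approx_errM.
Qed.
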